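(* The vectors $(1,4,10,13,12,9,3)$ and $(1,4,10,13,14,9,3)$ are pure $O$-sequences, whereas the vector $(1,4,10,13,13,9,3)$ is not a pure $O$-sequence.
   Context: An order ideal is a finite set of monomials of a polynomial ring closed under taking divisors; it is pure if all its maximal (with respect to divisibility) monomials have the same degree. The $f$-vector of an order ideal is $(f_0,\ldots,f_s)$, where $f_i$ is the number of its monomials of degree $i$ and $s$ is the largest degree. A pure $O$-sequence is a vector that is the $f$-vector of some pure order ideal. *)

(* Defs.v *)
From mathcomp Require Import all_boot.
From mathcomp Require Import finmap.
From mathcomp Require Import mpoly.

Set Implicit Arguments.
Unset Strict Implicit.
Unset Printing Implicit Defensive.

Local Open Scope fset_scope.

(* Monomials of a polynomial ring in n variables are the exponent vectors
   'X_{1..n}; divisibility is the pointwise order (_ <= _)%MM, not the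
   monomial order (_ <= _)%O. *)

Definition order_ideal (n : nat) (X : {fset 'X_{1..n}}) : Prop :=
  forall m m' : 'X_{1..n}, m \in X -> (m' <= m)%MM -> m' \in X.

Definition maximal_in (n : nat) (X : {fset 'X_{1..n}}) (m : 'X_{1..n}) : Prop :=
  m \in X /\ forall m' : 'X_{1..n}, m' \in X -> (m <= m')%MM -> m' = m.

Definition pure (n : nat) (X : {fset 'X_{1..n}}) : Prop :=
  forall m m' : 'X_{1..n},
    maximal_in X m -> maximal_in X m' -> mdeg m = mdeg m'.

Definition top_degree (n : nat) (X : {fset 'X_{1..n}}) : nat :=
  \max_(m <- X) mdeg m.

(* Only meaningful for nonempty X, since the empty set has no largest degree. *)
Definition f_vector (n : nat) (X : {fset 'X_{1..n}}) : seq nat :=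
  mkseq (fun i => #|` [fset m in X | mdeg m == i]|) (top_degree X).+1.

(* The number n of variables is arbitrary. In particular it may exceed the
   entry of degree 1, as X need not contain every variable. *)
Definition pure_O_sequence (h : seq nat) : Prop :=
  exists (n : nat) (X : {fset 'X_{1..n}}),
    [/\ X != fset0, order_ideal X, pure X & f_vector X = h].

(* Main.v *)
Require Import Defs.
From mathcomp Require Import all_boot.
From mathcomp Require Import finmap.
From mathcomp Require Import mpoly.

Set Implicit Arguments.
Unset Strict Implicit.
Unset Printing Implicit Defensive.

Local Open Scope fset_scope.

(** A pure order ideal is determined by its monomials of top degree, and only
    the [h_1] variables that it contains matter. So a pure O-sequence
    [(1, 4, ..., 9, 3)] with last degree 6 comes from three of the 84 monomials
    of degree 6 in four variables: explicit triples give the two positive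
    claims. No triple gives [(h_2, h_3, h_4, h_5) = (10, 13, 13, 9)], by
    evaluation of all 95284 triples. *)

(** * Monomials of a given degree as exponent lists *)

Fixpoint monomials (k d : nat) : seq (seq nat) :=
  if k is k'.+1 then
    flatten [seq [seq a :: r | r <- monomials k' (d - a)] | a <- iota 0 d.+1]
  else if d is 0 then [:: [::]] else [::].

Lemma mem_monomials (k d : nat) (q : seq nat) :
  (q \in monomials k d) = (size q == k) && (sumn q == d).
Proof.
elim: k d q => [|k IHk] d q; first by case: d => [|d]; case: q.
apply/flatten_mapP/andP => [[a]|[]].
  rewrite -/(iota 0 d.+1) mem_iota add0n ltnS => /= le_ad /mapP[r].
  rewrite IHk => /andP[/eqP sz_r /eqP deg_r] ->.
  by rewrite /= sz_r deg_r subnKC.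
case: q => [//|a r] /=; rewrite eqSS => sz_r /eqP <-.
exists a; first by rewrite -/(iota 0 _.+1) mem_iota add0n ltnS leq_addr.
by apply: map_f; rewrite IHk sz_r addKn eqxx.
Qed.

Lemma monomials_uniq (k d : nat) : uniq (monomials k d).
Proof.
elim: k d => [|k IHk] d; first by case: d.
apply: allpairs_uniq_dep => [|a _|]; [exact: iota_uniq|exact: IHk|].
by move=> [a r] [b s] _ _ /= [-> ->].
Qed.

(* The number of monomials of degree d in the order ideal generated by G. *)
Definition hilb (k : nat) (G : seq (seq nat)) (d : nat) : nat :=
  count (fun q => has (all2 leq q) G) (monomials k d).

(** The entries already chosen are absorbed into the predicate, so the subsequences of length [k]
    are tested one by one without building a list of them. *)
Fixpoint all_subseqs (T : Type) (k : nat) (P : pred (seq T)) (s : seq T) :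
    bool :=
  if k is k'.+1 then
    if s is x :: s' then
      all_subseqs k' (fun t => P (x :: t)) s' && all_subseqs k P s'
    else true
  else P [::].

Lemma all_subseqsP (T : eqType) (P : pred (seq T)) (s t : seq T) :
  all_subseqs (size t) P s -> subseq t s -> P t.
Proof.
elim: s t P => [|x s IHs] [|y t] P //= /andP[Px Ps].
by case: eqP => [-> /(IHs _ _ Px) | _ /(IHs (y :: t) _ Ps)].
Qed.

(** * Monomials in selected variables versus exponent lists *)

Section Exponents.
Variables (n : nat) (I : seq 'I_n).
Hypothesis uniqI : uniq I.
Implicit Types (m : 'X_{1..n}) (q : seq nat) (X : {fset 'X_{1..n}}).

Definition supported m : Prop := forall i, m i != 0 -> i \in I.
Definition exps m : seq nat := [seq m i | i <- I].
(* The index of a variable outside I is the size of I, where nth returns 0. *)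
Definition mon q : 'X_{1..n} := [multinom nth 0 q (index i I) | i < n].

Lemma size_exps m : size (exps m) = size I.
Proof. exact: size_map. Qed.

Lemma supported_mon q : size q = size I -> supported (mon q).
Proof.
move=> sz_q i; rewrite mnmE; apply: contraR => iNI.
by rewrite nth_default // sz_q memNindex.
Qed.

Lemma monK q : size q = size I -> exps (mon q) = q.
Proof.
move=> sz_q; apply: (@eq_from_nth _ 0); first by rewrite size_exps.
move=> j; rewrite size_exps => lt_j.
pose i0 := tnth (in_tuple I) (Ordinal lt_j).
by rewrite (nth_map i0) // mnmE index_uniq.
Qed.

Lemma expsK m : supported m -> mon (exps m) = m.
Proof.
move=> supp_m; apply/mnmP => i; rewrite mnmE.
have [iI|iNI] := boolP (i \in I).
  by rewrite (nth_map i) ?index_mem // nth_index.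
rewrite nth_default; last by rewrite size_exps memNindex.
by apply/esym/eqP; apply: contraNT iNI; apply: supp_m.
Qed.

Lemma sumn_exps m : supported m -> sumn (exps m) = mdeg m.
Proof.
move=> supp_m; rewrite mdegE sumnE big_map big_uniq //=.
rewrite [RHS](bigID (mem I)) /= [X in (_ + X)%N]big1 ?addn0 // => i iNI.
by apply/eqP; apply: contraNT iNI; apply: supp_m.
Qed.

Lemma mdeg_mon q : size q = size I -> mdeg (mon q) = sumn q.
Proof. by move=> sz_q; rewrite -sumn_exps ?monK //; apply: supported_mon. Qed.

Lemma lem_exps m m' : supported m -> (m <= m')%MM = all2 leq (exps m) (exps m').
Proof.
move=> supp_m; rewrite /exps all2E !size_map eqxx /= zip_map all_map.
apply/mnm_lepP/allP => [le_mm' i _|le_mm' i]; first exact: le_mm'.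
by case: (eqVneq (m i) 0) => [->|/supp_m /le_mm'].
Qed.

(** On monomials supported on [I], [exps] is injective with inverse [mon] and preserves degree, so
    counting can be moved to exponent lists. *)
Lemma card_degree X d :
  (forall m, m \in X -> supported m) ->
  #|` [fset m in X | mdeg m == d]| =
  count (fun q => mon q \in X) (monomials (size I) d).
Proof.
move=> supp_X; rewrite -size_filter -(size_map exps).
apply/perm_size/uniq_perm => [||q].
- rewrite map_inj_in_uniq ?fset_uniq // => m m'.
  rewrite !inE => /andP[/supp_X sm _] /andP[/supp_X sm' _] e_mm'.
  by rewrite -(expsK sm) e_mm' expsK.
- by rewrite filter_uniq ?monomials_uniq.
rewrite mem_filter mem_monomials; apply/mapP/and3P => [[m]|].
  rewrite !inE => /andP[mX /eqP deg_m] ->; have sm := supp_X m mX.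
  by rewrite expsK // size_exps sumn_exps // deg_m.
case=> qX /eqP sz_q /eqP deg_q; exists (mon q); last by rewrite monK.
by rewrite !inE qX mdeg_mon // deg_q /=.
Qed.

End Exponents.

(** * Maximal monomials and purity *)

Section TopDegree.
Variables (n : nat) (X : {fset 'X_{1..n}}).
Implicit Types m : 'X_{1..n}.

Lemma mdeg_le_top m : m \in X -> mdeg m <= top_degree X.
Proof. by move=> mX; apply: leq_bigmax_seq. Qed.

Lemma lem_mdeg_eq m m' : (m <= m')%MM -> mdeg m' <= mdeg m -> m' = m.
Proof.
(* Factor [m'] as a quotient times [m]; the degree bound leaves degree 0 for the quotient. *)
move=> le_mm'; rewrite -{1 2}(submK le_mm') mdegD -{2}[mdeg m]add0n leq_add2r.
by rewrite leqn0 mdeg_eq0 => /eqP ->; rewrite add0m.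
Qed.

(** Among the multiples of [m] in the finite set [X], one of greatest degree is maximal. *)
Lemma maximal_above m :
  m \in X -> exists2 m', maximal_in X m' & (m <= m')%MM.
Proof.
move=> mX.
have le_mm : (m <= val [` mX])%MM by apply: lepm_refl.
case: (@arg_maxnP X [` mX] (fun x => (m <= val x)%MM)
  (fun x => mdeg (val x)) le_mm) => x le_mx max_x.
exists (val x) => //; split; first exact: valP.
move=> m' m'X le_xm'; apply: lem_mdeg_eq => //.
exact: (max_x [` m'X] (lepm_trans le_mx le_xm')).
Qed.

Lemma top_degree_attained :
  X != fset0 -> exists2 m, m \in X & mdeg m = top_degree X.
Proof.
case/fset0Pn => m0 m0X.
case: (@arg_maxnP X [` m0X] xpredT (fun x => mdeg (val x)) isT) => x _ max_x.
exists (val x); first exact: valP.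
apply/eqP; rewrite eqn_leq mdeg_le_top ?(valP x) //=.
by apply/bigmax_leqP_seq => m mX _; apply: (max_x [` mX]).
Qed.

(** A monomial of top degree is itself maximal, so purity gives every maximal monomial the top
    degree. *)
Lemma pure_divides_top m :
  pure X -> m \in X ->
  exists m', [/\ m' \in X, (m <= m')%MM & mdeg m' = top_degree X].
Proof.
move=> pureX mX; have [m' max_m' le_mm'] := maximal_above mX.
have /top_degree_attained[t tX deg_t] : X != fset0 by apply/fset0Pn; exists m.
exists m'; split=> //; first by case: max_m'.
rewrite -deg_t; apply: pureX => //; split=> // u uX le_tu.
by apply: lem_mdeg_eq => //; rewrite deg_t mdeg_le_top.
Qed.

End TopDegree.

(** * Pure order ideals and their generators *)

Lemma all2_leq_sumn (q r : seq nat) : all2 leq q r -> sumn q <= sumn r.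
Proof.
by elim: q r => [|a q IHq] [|b r] //= /andP[? /IHq]; apply: leq_add.
Qed.

Lemma all2_leq_size (q r : seq nat) : all2 leq q r -> size q = size r.
Proof. by rewrite all2E => /andP[/eqP]. Qed.

Lemma all2_leq_refl (q : seq nat) : all2 leq q q.
Proof. by elim: q => //= a q ->; rewrite leqnn. Qed.

Lemma all2_leq_trans (q r t : seq nat) :
  all2 leq q r -> all2 leq r t -> all2 leq q t.
Proof.
elim: q r t => [|a q IHq] [|b r] [|c t] //= /andP[ab qr] /andP[bc rt].
by rewrite (leq_trans ab bc) (IHq _ _ qr rt).
Qed.

(** The divisors of members of [G] form an order ideal; a maximal one divides some generator, hence
    equals it and has degree [s]. *)
Lemma pure_O_sequence_hilb (k s : nat) (G : seq (seq nat)) :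
  G != [::] -> {subset G <= monomials k s} ->
  pure_O_sequence (mkseq (hilb k G) s.+1).
Proof.
move=> G_neq0 sGM; exists k.
pose I := enum 'I_k; have uI : uniq I by apply: enum_uniq.
have szI : size I = k by rewrite size_enum_ord.
have supp (m : 'X_{1..k}) : supported I m by move=> i _; rewrite mem_enum.
pose L := [seq q <- flatten [seq monomials k d | d <- iota 0 s.+1]
          | has (all2 leq q) G].
pose X := [fset mon I q | q in L].
have G_size g : g \in G -> size g = k.
  by move/sGM; rewrite mem_monomials => /andP[/eqP].
have G_deg g : g \in G -> sumn g = s.
  by move/sGM; rewrite mem_monomials => /andP[_ /eqP].
have memL q : (q \in L) = has (all2 leq q) G.
  rewrite mem_filter andb_idr // => /hasP[g gG le_qg].
  apply/flatten_mapP; exists (sumn q).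
    by rewrite mem_iota add0n ltnS /= -(G_deg g gG) all2_leq_sumn.
  by rewrite mem_monomials eqxx andbT (all2_leq_size le_qg) G_size.
have memX m : (m \in X) = has (all2 leq (exps I m)) G.
  apply/imfsetP/idP => [[q /=]|hm]; last first.
    by exists (exps I m); rewrite /= ?memL // expsK.
  rewrite memL => hq ->; rewrite monK //.
  by have /hasP[g gG /all2_leq_size ->] := hq; rewrite G_size.
have [g gG] : exists g, g \in G.
  by case: (G) G_neq0 => // g G' _; exists g; apply: mem_head.
have gX q : q \in G -> mon I q \in X.
  move=> qG; rewrite memX monK ?G_size //.
  by apply/hasP; exists q => //; apply: all2_leq_refl.
have deg_mon q : q \in G -> mdeg (mon I q) = s.
  by move=> qG; rewrite mdeg_mon ?G_size // G_deg.
have topX : top_degree X = s.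
  apply/eqP; rewrite eqn_leq -{2}(deg_mon g gG) mdeg_le_top ?gX // andbT.
  apply/bigmax_leqP_seq => m; rewrite memX => /hasP[r rG le_mr] _.
  by rewrite -(sumn_exps uI (supp m)) -(G_deg r rG) all2_leq_sumn.
exists X; split.
- by apply/fset0Pn; exists (mon I g); apply: gX.
- move=> m m' mX; move: mX; rewrite !memX => /hasP[r rG le_mr].
  rewrite (lem_exps _ (supp m')) => le_m'm; apply/hasP; exists r => //.
  exact: all2_leq_trans le_mr.
- have deg_max m : maximal_in X m -> mdeg m = s.
    case=> mX max_m; have := mX; rewrite memX => /hasP[r rG le_mr].
    rewrite -(max_m _ (gX r rG)) ?deg_mon // (lem_exps _ (supp m)) monK //.
    by rewrite G_size.
  by move=> m m' /deg_max -> /deg_max ->.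
rewrite /f_vector topX; apply: eq_mkseq => d.
rewrite (card_degree uI) ?szI => [|m _]; last exact: supp.
apply: eq_in_count => q; rewrite mem_monomials => /andP[/eqP sz_q _].
by rewrite memX monK ?szI.
Qed.

(** Having at least two entries makes the top degree positive, so [nth 0 h 1] really counts the
    variables in the ideal rather than being a default value. *)
Lemma hilb_of_pure_O_sequence (h : seq nat) :
    1 < size h -> pure_O_sequence h ->
  exists G : seq (seq nat),
    [/\ subseq G (monomials (nth 0 h 1) (size h).-1), size G = last 0 h
      & h = mkseq (hilb (nth 0 h 1) G) (size h)].
Proof.
move=> sz_h [n [X [_ idX pureX fX]]].
set k := nth 0 h 1; set s := (size h).-1.
have topX : top_degree X = s by rewrite /s -fX size_mkseq.
have s_gt0 : 0 < s by rewrite -ltnS prednK // (ltn_trans _ sz_h).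
(* Closure under divisors puts every variable dividing a member of [X] into [X]. *)
pose I := [seq i <- enum 'I_n | U_(i)%MM \in X].
have uI : uniq I by rewrite filter_uniq ?enum_uniq.
have supp m : m \in X -> supported I m.
  move=> mX i mi; rewrite mem_filter mem_enum andbT.
  by apply: (idX m) => //; rewrite lep1mP.
have h_card d : d <= s ->
    nth 0 h d = count (fun q => mon I q \in X) (monomials (size I) d).
  by move=> le_ds; rewrite -fX nth_mkseq ?topX // (card_degree uI).
have szI : size I = k.
  rewrite /k -fX nth_mkseq ?topX // -(size_map (fun i : 'I_n => U_(i)%MM)).
  apply/perm_size/uniq_perm => [||m].
  - by rewrite map_inj_uniq // => i j /eqP; rewrite eq_mnm1 => /eqP.
  - exact: fset_uniq.
  rewrite !inE /=; apply/mapP/andP => [[i]|[mX /mdeg1P[i /eqP e_m]]].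
    by rewrite mem_filter => /andP[Xi _] ->; rewrite mdeg1.
  by exists i => //; rewrite mem_filter -e_m mX mem_enum.
rewrite szI in h_card.
(* The top-degree members of [X], which generate it by purity. *)
pose G := [seq q <- monomials k s | mon I q \in X].
have memX q : size q = k -> (mon I q \in X) = has (all2 leq q) G.
  move=> sz_q; apply/idP/hasP => [qX|[g]].
    have [m [mX le_qm deg_m]] := pure_divides_top pureX qX.
    have sm := supp m mX; exists (exps I m).
      rewrite mem_filter expsK // mX mem_monomials size_exps szI sumn_exps //.
      by rewrite deg_m topX !eqxx.
    move: le_qm; rewrite (@lem_exps _ I) ?monK ?szI //.
    by apply: supported_mon; rewrite szI.
  rewrite mem_filter mem_monomials => /and3P[gX /eqP sz_g _] le_qg.
  apply: (idX _ _ gX); rewrite (@lem_exps _ I) ?monK ?szI //.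
  by apply: supported_mon; rewrite szI.
exists G; split; first exact: filter_subseq.
  by rewrite size_filter -h_card // -nth_last.
apply: (@eq_from_nth _ 0); first by rewrite size_mkseq.
move=> d lt_d; rewrite nth_mkseq // h_card; last first.
  by rewrite -ltnS prednK // (ltn_trans _ sz_h).
by apply: eq_in_count => q; rewrite mem_monomials => /andP[/eqP /memX].
Qed.

(* Nested conditionals rather than [&&]: under call-by-value evaluation [&&]
   would compute all four values for every triple. *)
Lemma no_three_generators :
  all_subseqs 3 (fun G =>
    if hilb 4 G 2 == 10 then
      if hilb 4 G 3 == 13 then
        if hilb 4 G 5 == 9 then hilb 4 G 4 != 13 else true
      else true
    else true) (monomials 4 6).
Proof. by vm_compute. Qed.

Theorem mainTheorem11 :
  [/\ pure_O_sequence [:: 1; 4; 10; 13; 12; 9; 3],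
      pure_O_sequence [:: 1; 4; 10; 13; 14; 9; 3]
    & ~ pure_O_sequence [:: 1; 4; 10; 13; 13; 9; 3]].
Proof.
split.
(* In variables x, y, z, w: x^3 times the orbit of y^2 z under the cycle y, z, w. *)
- pose G := [:: [:: 3; 2; 1; 0]; [:: 3; 1; 0; 2]; [:: 3; 0; 2; 1]].
  have -> : [:: 1; 4; 10; 13; 12; 9; 3] = mkseq (hilb 4 G) 7 by vm_compute.
  by apply: pure_O_sequence_hilb => //; apply/allP; vm_compute.
(* The generators x^4 y^2, x^3 yzw and x^2 z^2 w^2. *)
- pose G := [:: [:: 4; 2; 0; 0]; [:: 3; 1; 1; 1]; [:: 2; 0; 2; 2]].
  have -> : [:: 1; 4; 10; 13; 14; 9; 3] = mkseq (hilb 4 G) 7 by vm_compute.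
  by apply: pure_O_sequence_hilb => //; apply/allP; vm_compute.
move=> /hilb_of_pure_O_sequence[] // G [sub_G sz_G].
rewrite /= => -[_ _ h2 h3 h4 h5 _].
(* Only the first 3 is the number of generators; the later one is a degree. Substituting the entries
   of the vector then reduces the test to [13 != 13]. *)
have := no_three_generators; rewrite -{1}[3]sz_G => /all_subseqsP /(_ sub_G).
by rewrite -h2 -h3 -h4 -h5.
Qed.
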